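(* Let $\mu=\sum_{j=1}^N\omega_j\delta_{x_j}$ and $\nu=\sum_{i=1}^M\vartheta_i\delta_{y_i}$ be finitely supported probability measures on $\mathbb{R}$ with $x_1<\dots<x_N$, $y_1<\dots<y_M$, all $\omega_j,\vartheta_i>0$, $\mu\leq_c\nu$, $\mu\neq\nu$ and $N\ge 2$. Then the algorithm described in the context, applied to $(\mu,\nu)$, terminates after a finite number of steps and its output $\mathbb{Q}=\sum_{j,i}q_{j,i}\delta_{(x_j,y_i)}$ is the left-monotone martingale transport plan of $\mu$ and $\nu$, i.e. $\mathbb{Q}\in\mathcal{M}_2(\mu,\nu)$ and $\mathbb{Q}$ is left-monotone.
   Context: Notation: $N,M\in\mathbb{N}$, $\sum_j\omega_j=\sum_i\vartheta_i=1$, $\delta_x$ is the Dirac measure at $x$, and $\mathrm{supp}$ is the support of a measure. Convex order: $\mu\leq_c\nu$ means $\int f\,d\mu\le\int f\,d\nu$ for every convex $f:\mathbb{R}\to\mathbb{R}$ for which the integrals exist. $\mathcal{M}_2(\mu,\nu)$ is the set of martingale transport plans, i.e. of probability measures $\mathbb{Q}=\sum_{j=1}^N\sum_{i=1}^M q_{j,i}\delta_{(x_j,y_i)}$ with $q_{j,i}\ge0$, $\sum_{i}q_{j,i}=\omega_j$ for all $j$, $\sum_j q_{j,i}=\vartheta_i$ for all $i$, and $\sum_i q_{j,i}(y_i-x_j)=0$ for all $j$. $\mathbb{Q}\in\mathcal{M}_2(\mu,\nu)$ is left-monotone if there is a set $\Gamma\subseteq\mathrm{supp}(\mu)\times\mathrm{supp}(\nu)$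 with $\mathbb{Q}(\Gamma)=1$ such that for all $(x,y^-),(x,y^+),(x',y')\in\Gamma$ with $x<x'$ one has $y'\notin(y^-,y^+)$. Algorithm. Maintain a list of remaining atoms of $\mu$ and a list of remaining atoms of $\nu$ (initially all atoms), current remaining masses $\omega_j$, $\vartheta_i$ (initially the given ones), and transported masses $q_{j,i}$ (initially all $0$). Whenever mass is transported from $x_j$ to $y_i$ in several steps, the amounts are added up in $q_{j,i}$. As long as there are remaining atoms of $\mu$, perform the following step. Let $x$ be the smallest remaining atom of $\mu$, with current mass $\omega$. Case I: $x=y_\ell$ for some remaining atom $y_\ell$ of $\nu$, with current mass $\vartheta_\ell$. - Case I.1: $\omega\le\vartheta_\ell$. Transport mass $\omega$ from $x$ to $y_\ell$; replace $\vartheta_\ell$ by $\vartheta_\ell-\omega$ and $\omega$ by $0$; cross $x$ from the list (and also $y_\ell$ if its mass is now $0$). - Case I.2: $\omega>\vartheta_\ell$. Transport mass $\vartheta_\ell$ from $x$ to $y_\ell$; replace $\omega$ by $\omega-\vartheta_\ell$ and $\vartheta_\ell$ by $0$; cross $y_\ell$ from the list. Case II: there are two consecutive remaining atoms $y_\ell<y_r$ of $\nu$ (no remaining atom of $\nu$ in between) with $y_\ell<x<y_r$, with current masses $\vartheta_\ell,\vartheta_r$. Let $\vartheta'_\ell,\vartheta'_r\ge0$ be the unique solution of $\vartheta'_\ell+\vartheta'_r=\omega$, $\vartheta'_\ell y_\ell+\vartheta'_r y_r=\omega x$. - Case II.1: $\vartheta'_\ell\le\vartheta_\ell$ and $\vartheta'_r\le\vartheta_r$.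 Transport $\vartheta'_\ell$ from $x$ to $y_\ell$ and $\vartheta'_r$ from $x$ to $y_r$; replace $\omega$ by $0$, $\vartheta_\ell$ by $\vartheta_\ell-\vartheta'_\ell$, $\vartheta_r$ by $\vartheta_r-\vartheta'_r$; cross $x$ from the list (and also $y_\ell$, $y_r$ if their masses are now $0$). - Case II.2: $\vartheta'_\ell>\vartheta_\ell$ and $\vartheta'_r\le\vartheta_r$. Put $k=\vartheta_\ell/\vartheta'_\ell$. Transport $\vartheta_\ell$ from $x$ to $y_\ell$ and $k\vartheta'_r$ from $x$ to $y_r$; replace $\omega$ by $\omega(1-k)$, $\vartheta_r$ by $\vartheta_r-k\vartheta'_r$, $\vartheta_\ell$ by $0$; cross $y_\ell$ from the list. - Case II.3: $\vartheta'_\ell\le\vartheta_\ell$ and $\vartheta'_r>\vartheta_r$. Put $k=\vartheta_r/\vartheta'_r$. Transport $k\vartheta'_\ell$ from $x$ to $y_\ell$ and $\vartheta_r$ from $x$ to $y_r$; replace $\omega$ by $\omega(1-k)$, $\vartheta_\ell$ by $\vartheta_\ell-k\vartheta'_\ell$, $\vartheta_r$ by $0$; cross $y_r$ from the list. - Case II.4: $\vartheta'_\ell>\vartheta_\ell$ and $\vartheta'_r>\vartheta_r$. Let $k=\min\{\vartheta_\ell/\vartheta'_\ell,\vartheta_r/\vartheta'_r\}$. If $k=\vartheta_\ell/\vartheta'_\ell$ perform the operations of Case II.2; if $k=\vartheta_r/\vartheta'_r$ perform the operations of Case II.3 (if both equalities hold, either may be used). All masses not mentioned are left unchanged. The output is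 the family $(q_{j,i})$. *)

(* Defs.v *)
From Stdlib Require Export Relation_Operators.
From mathcomp Require Export all_boot all_order all_algebra.
From mathcomp Require Export all_classical all_reals all_analysis.

Set Implicit Arguments.
Unset Strict Implicit.
Unset Printing Implicit Defensive.

Import Order.TTheory GRing.Theory Num.Theory.
Import numFieldNormedType.Exports.

Local Open Scope classical_set_scope.
Local Open Scope ring_scope.

Definition atomic_measure d (T : measurableType d) (R : realType) (I : finType)
    (a : I -> T) (w : I -> R) (mu : set T -> \bar R) : Prop :=
  forall A, measurable A -> mu A = (\sum_i (w i)%:E * \d_(a i) A)%E.

Definition msupport (R : realType) (mu : set (measurableTypeR R) -> \bar R) :
    set (measurableTypeR R) :=
  [set a | forall U : set R, open U -> U a -> (0 < mu U)%E].

Definition convex_order (R : realType)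
    (mu nu : {measure set (measurableTypeR R) -> \bar R}) : Prop :=
  forall f : R -> R, @convex_function R R^o [set: R] f ->
    mu.-integrable [set: R] (EFin \o f) ->
    nu.-integrable [set: R] (EFin \o f) ->
    (\int[mu]_a (f a)%:E <= \int[nu]_a (f a)%:E)%E.

Section Plans.
Variables (R : realType) (N M : nat).
Local Notation BR := (measurableTypeR R).

Definition atom_pair (x : 'I_N -> R) (y : 'I_M -> R) (ji : 'I_N * 'I_M) :
  BR * BR := (x ji.1, y ji.2).

Definition plan_of (x : 'I_N -> R) (y : 'I_M -> R) (q : 'I_N -> 'I_M -> R)
    (Q : probability (BR * BR)%type R) : Prop :=
  atomic_measure (atom_pair x y) (fun ji => q ji.1 ji.2) Q.

Definition martingale_plans (x omega : 'I_N -> R) (y theta : 'I_M -> R) :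
    set (probability (BR * BR)%type R) :=
  [set Q | exists q : 'I_N -> 'I_M -> R,
    [/\ plan_of x y q Q,
        forall j i, 0 <= q j i,
        forall j, \sum_(i < M) q j i = omega j,
        forall i, \sum_(j < N) q j i = theta i &
        forall j, \sum_(i < M) q j i * (y i - x j) = 0]].

Definition left_monotone (mu nu : probability BR R)
    (Q : probability (BR * BR)%type R) : Prop :=
  exists Gamma : set (BR * BR),
    [/\ measurable Gamma,
        Gamma `<=` msupport mu `*` msupport nu,
        Q Gamma = 1%E &
        forall a b1 b2 a' b' : R,
          Gamma (a, b1) -> Gamma (a, b2) -> Gamma (a', b') -> a < a' ->
          ~ (b1 < b' < b2)].

End Plans.

Section Algorithm.
Variables (R : realType) (N M : nat).

Record state := State {
  rem_mu : {set 'I_N};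
  rem_nu : {set 'I_M};
  mass_mu : 'I_N -> R;
  mass_nu : 'I_M -> R;
  moved : 'I_N -> 'I_M -> R }.

Definition init_state (omega : 'I_N -> R) (theta : 'I_M -> R) : state :=
  State [set: 'I_N]%SET [set: 'I_M]%SET omega theta (fun _ _ => 0).

Definition add_moved (q : 'I_N -> 'I_M -> R) (j : 'I_N) (i : 'I_M) (m : R) :
    'I_N -> 'I_M -> R :=
  fun j' i' => if (j' == j) && (i' == i) then q j' i' + m else q j' i'.

Definition cross_if_empty (v : 'I_M -> R) (i : 'I_M) (B : {set 'I_M}) :
    {set 'I_M} :=
  if v i == 0 then (B :\ i)%SET else B.

Variables (x : 'I_N -> R) (y : 'I_M -> R).

Definition smallest_atom (A : {set 'I_N}) (j : 'I_N) : Prop :=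
  j \in A /\ forall j', j' \in A -> x j <= x j'.

Definition consecutive_atoms (B : {set 'I_M}) (l r : 'I_M) : Prop :=
  [/\ l \in B, r \in B, y l < y r &
      forall i, i \in B -> ~ (y l < y i < y r)].

(* For y l < a < y r, the pair (tl, tr) is uniquely determined. *)
Definition split_mass (w a : R) (l r : 'I_M) (tl tr : R) : Prop :=
  [/\ 0 <= tl, 0 <= tr, tl + tr = w & tl * y l + tr * y r = w * a].

(* tl and tr are the masses that would have to go to y_l and y_r in order to
   empty x_j; only the fraction k of them is moved, which uses up y_l. *)
Definition exhaust_left (s : state) (j : 'I_N) (l r : 'I_M) (tl tr : R) :
    state :=
  let: State A B w v q := s in
  let k := v l / tl in
  State A (B :\ l)%SET
    [eta w with j |-> w j * (1 - k)]
    [eta v with l |-> 0, r |-> v r - k * tr]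
    (add_moved (add_moved q j l (v l)) j r (k * tr)).

Definition exhaust_right (s : state) (j : 'I_N) (l r : 'I_M) (tl tr : R) :
    state :=
  let: State A B w v q := s in
  let k := v r / tr in
  State A (B :\ r)%SET
    [eta w with j |-> w j * (1 - k)]
    [eta v with l |-> v l - k * tl, r |-> 0]
    (add_moved (add_moved q j l (k * tl)) j r (v r)).

Inductive step : state -> state -> Prop :=
| step_I1 (A : {set 'I_N}) (B : {set 'I_M}) (w : 'I_N -> R)
    (v : 'I_M -> R) (q : 'I_N -> 'I_M -> R) (j : 'I_N) (l : 'I_M) :
    smallest_atom A j -> l \in B -> x j = y l ->
    w j <= v l ->
    let v' : 'I_M -> R := [eta v with l |-> v l - w j] in
    step (State A B w v q)
      (State (A :\ j)%SET (cross_if_empty v' l B)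
         [eta w with j |-> 0] v' (add_moved q j l (w j)))
| step_I2 (A : {set 'I_N}) (B : {set 'I_M}) (w : 'I_N -> R)
    (v : 'I_M -> R) (q : 'I_N -> 'I_M -> R) (j : 'I_N) (l : 'I_M) :
    smallest_atom A j -> l \in B -> x j = y l ->
    v l < w j ->
    step (State A B w v q)
      (State A (B :\ l)%SET
         [eta w with j |-> w j - v l] [eta v with l |-> 0]
         (add_moved q j l (v l)))
| step_II1 (A : {set 'I_N}) (B : {set 'I_M}) (w : 'I_N -> R)
    (v : 'I_M -> R) (q : 'I_N -> 'I_M -> R) (j : 'I_N) (l r : 'I_M)
    (tl tr : R) :
    smallest_atom A j -> consecutive_atoms B l r -> y l < x j < y r ->
    split_mass (w j) (x j) l r tl tr ->
    tl <= v l -> tr <= v r ->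
    let v' : 'I_M -> R := [eta v with l |-> v l - tl, r |-> v r - tr] in
    step (State A B w v q)
      (State (A :\ j)%SET (cross_if_empty v' l (cross_if_empty v' r B))
         [eta w with j |-> 0] v' (add_moved (add_moved q j l tl) j r tr))
| step_II2 (s : state) (j : 'I_N) (l r : 'I_M) (tl tr : R) :
    smallest_atom (rem_mu s) j -> consecutive_atoms (rem_nu s) l r ->
    y l < x j < y r -> split_mass (mass_mu s j) (x j) l r tl tr ->
    mass_nu s l < tl -> tr <= mass_nu s r ->
    step s (exhaust_left s j l r tl tr)
| step_II3 (s : state) (j : 'I_N) (l r : 'I_M) (tl tr : R) :
    smallest_atom (rem_mu s) j -> consecutive_atoms (rem_nu s) l r ->
    y l < x j < y r -> split_mass (mass_mu s j) (x j) l r tl tr ->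
    tl <= mass_nu s l -> mass_nu s r < tr ->
    step s (exhaust_right s j l r tl tr)
| step_II4_left (s : state) (j : 'I_N) (l r : 'I_M) (tl tr : R) :
    smallest_atom (rem_mu s) j -> consecutive_atoms (rem_nu s) l r ->
    y l < x j < y r -> split_mass (mass_mu s j) (x j) l r tl tr ->
    mass_nu s l < tl -> mass_nu s r < tr ->
    Num.min (mass_nu s l / tl) (mass_nu s r / tr) = mass_nu s l / tl ->
    step s (exhaust_left s j l r tl tr)
| step_II4_right (s : state) (j : 'I_N) (l r : 'I_M) (tl tr : R) :
    smallest_atom (rem_mu s) j -> consecutive_atoms (rem_nu s) l r ->
    y l < x j < y r -> split_mass (mass_mu s j) (x j) l r tl tr ->
    mass_nu s l < tl -> mass_nu s r < tr ->
    Num.min (mass_nu s l / tl) (mass_nu s r / tr) = mass_nu s r / tr ->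
    step s (exhaust_right s j l r tl tr).

Definition reachable : state -> state -> Prop := clos_refl_trans state step.

(* Every run is finite, and a run can only stop when no atom of mu is left. *)
Definition terminates (s : state) : Prop :=
  Acc (fun s2 s1 => step s1 s2) s /\
  forall s', reachable s s' -> rem_mu s' <> finset.set0 ->
    exists s'', step s' s''.

(* An execution need not be unique because the last two constructors
   of step overlap when the two quotients are equal. *)
Definition output (s : state) (q : 'I_N -> 'I_M -> R) : Prop :=
  exists s', [/\ reachable s s', rem_mu s' = finset.set0 & moved s' = q].

End Algorithm.

(* Main.v *)
Require Import Defs.
From HB Require Import structures.
From mathcomp Require Import measurable_realfun ring lra.
Import Order.TTheory GRing.Theory Num.Theory.
Import numFieldNormedType.Exports.
Local Open Scope classical_set_scope.
Local Open Scope ring_scope.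
Set Implicit Arguments.
Unset Strict Implicit.
Unset Printing Implicit Defensive.

(** The algorithm always sends mass from the leftmost remaining atom of mu to
    the nearest remaining atoms of nu around it, in such a way that the mass
    sent has this atom as its barycentre ([nearest_transfer]).  Two facts about
    such transfers prove the theorem.

    First, they keep the remaining parts of mu and nu in convex order
    ([cx_le_transfer]).  Compare the potential functions, the integrals of
    [|t - a|] in [a]: a transfer lowers the potential of nu relative to that of
    mu only between the two targets.  Left of the leftmost atom of mu the
    potential of mu is the least one possible for the common mean; between this
    atom and the right target the difference of the potentials is concave and
    nonnegative at both ends.  Convex order of the remainders in turn yields
    remaining atoms of nu on both sides of the leftmost atom of mu
    ([targets_surround]), so a run cannot stop before mu is used up
    ([step_exists]).  As every step crosses out an atom, every run is finite
    ([step_Acc]).  At the end nu is used up too, because the remaining masses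
    agree, so the masses moved have the right marginals
    ([marginals_final]); they have the martingale property since each single
    transfer has it.

    Second, since the nearest targets are used, no target that still remains
    lies strictly between a source and a target that it has used.  Hence
    the sources further right, which are served later from the remaining
    targets, never reach strictly between two targets of an earlier source.
    This is left-monotonicity ([run_invariant_transfer]), with the set of pairs
    carrying positive mass as the witness. *)

(** * Finite sums and absolute values *)

Lemma sum_decr_at (R : realType) (I : finType) (w w' : I -> R) (j : I) (c : R)
    (f : I -> R) :
  (forall i, w' i = w i - (i == j)%:R * c) ->
  \sum_i w' i * f i = \sum_i w i * f i - c * f j.
Proof.
move=> E; rewrite (bigD1 j) //= [in RHS](bigD1 j) //= E eqxx mul1r.
rewrite (eq_bigr (fun i => w i * f i)); first by ring.
by move=> i /negbTE ij; rewrite E ij mul0r subr0.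
Qed.

Lemma sum_decr_at2 (R : realType) (I : finType) (v v' : I -> R) (l r : I)
    (a b : R) (f : I -> R) :
  (forall i, v' i = v i - (i == l)%:R * a - (i == r)%:R * b) ->
  \sum_i v' i * f i = \sum_i v i * f i - a * f l - b * f r.
Proof.
move=> E; rewrite (sum_decr_at f E) (@sum_decr_at _ _ v _ l a f) //.
Qed.

(** [t |-> |t - c|] is convex, so it lies below its chord over [p, q]. *)
Lemma abs_chord (R : realType) (c p t q : R) : p <= t <= q ->
  (q - p) * `|t - c| <= (q - t) * `|p - c| + (t - p) * `|q - c|.
Proof.
move=> /andP[pt tq].
have [qp qt tp] : [/\ 0 <= q - p, 0 <= q - t & 0 <= t - p].
  by rewrite !subr_ge0; split=> //; exact: le_trans tq.
rewrite -[q - p]ger0_norm // -[q - t]ger0_norm // -[t - p]ger0_norm // -!normrM.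
apply: le_trans (ler_normD _ _); rewrite le_eqVlt; apply/orP; left.
by apply/eqP; congr `|_|; ring.
Qed.

(** Away from its kink [c] the function [t |-> |t - c|] is affine. *)
Lemma abs_chord_eq (R : realType) (c p t q : R) : p <= t <= q ->
  c <= p \/ q <= c ->
  (q - p) * `|t - c| = (q - t) * `|p - c| + (t - p) * `|q - c|.
Proof.
move=> /andP[pt tq] [cp|qc].
  by rewrite !ger0_norm ?subr_ge0 //; [ring|lra..].
by rewrite !ler0_norm ?subr_le0 //; [ring|lra..].
Qed.

Lemma sum_delta (R : realType) (I : finType) (j : I) (f : I -> R) :
  \sum_i (i == j)%:R * f i = f j.
Proof.
rewrite (bigD1 j) //= eqxx mul1r big1 ?addr0 // => i /negbTE ->.
by rewrite mul0r.
Qed.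

(** * The invariant of a run *)

Section Runs.
Variables (R : realType) (N M : nat).
Variables (x omega : 'I_N -> R) (y theta : 'I_M -> R).
Implicit Types (w : 'I_N -> R) (v : 'I_M -> R) (s : state R N M).

(** Convex order of two finitely supported measures of equal mass and mean, in
    terms of their potential functions [t |-> \int |t - a|]: on the line this
    one-parameter family of convex functions decides the order. *)
Record cx_le w v : Prop := CxLe {
  cx_mass : \sum_j w j = \sum_i v i;
  cx_mean : \sum_j w j * x j = \sum_i v i * y i;
  cx_potential :
    forall t, \sum_j w j * `|t - x j| <= \sum_i v i * `|t - y i| }.

Lemma affine_eq w v (t : R) :
  \sum_j w j = \sum_i v i -> \sum_j w j * x j = \sum_i v i * y i ->
  \sum_j w j * (x j - t) = \sum_i v i * (y i - t).
Proof.
move=> mass mean.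
under eq_bigr do rewrite mulrBr.
under [RHS]eq_bigr do rewrite mulrBr.
by rewrite !sumrB mean -!mulr_suml mass.
Qed.

(** The common shape of all cases of the algorithm: the leftmost remaining atom
    [x j] sends mass [a] to the nearest remaining target [y l] on its left and
    mass [b] to the nearest remaining target [y r] on its right, with
    barycentre [x j].  The case [x j = y l] is [l = r] and [b = 0].  Atoms that
    run empty may be crossed out; an atom of mu stays exactly as long as it
    carries mass, whereas an empty atom of nu may stay in the list, which
    happens when two quotients tie and only one target is crossed out. *)
Record nearest_transfer s s' (j : 'I_N) (l r : 'I_M) (a b : R) : Prop :=
  NearestTransfer {
  tr_min : smallest_atom x (rem_mu s) j;
  tr_l : l \in rem_nu s;
  tr_r : r \in rem_nu s;
  tr_lx : y l <= x j;
  tr_xr : x j <= y r;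
  tr_left : forall i, i \in rem_nu s -> y i <= x j -> y i <= y l;
  tr_right : forall i, i \in rem_nu s -> x j <= y i -> y r <= y i;
  tr_a : 0 <= a;
  tr_b : 0 <= b;
  tr_bary : a * y l + b * y r = (a + b) * x j;
  tr_w : forall k, mass_mu s' k = mass_mu s k - (k == j)%:R * (a + b);
  tr_v : forall i,
    mass_nu s' i = mass_nu s i - (i == l)%:R * a - (i == r)%:R * b;
  tr_q : forall k i, moved s' k i =
    moved s k i + (k == j)%:R * ((i == l)%:R * a + (i == r)%:R * b);
  tr_A : {subset rem_mu s' <= rem_mu s};
  tr_B : {subset rem_nu s' <= rem_nu s};
  tr_w0 : forall k, 0 <= mass_mu s' k;
  tr_wA : forall k, (k \in rem_mu s') = (0 < mass_mu s' k);
  tr_v0 : forall i, 0 <= mass_nu s' i;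
  tr_vB : forall i, i \notin rem_nu s' -> mass_nu s' i = 0 }.

(** The last three fields are about left-monotonicity.  [ri_gap]: no remaining
    target lies between [x j] and a target that [x j] has used.  [ri_future]:
    only the leftmost remaining atom of mu has ever sent mass, besides those
    already finished.  Together they make every new transfer respect
    [ri_mono], which is left-monotonicity of the masses moved so far. *)
Record run_invariant s : Prop := RunInvariant {
  ri_w0 : forall j, 0 <= mass_mu s j;
  ri_wA : forall j, (j \in rem_mu s) = (0 < mass_mu s j);
  ri_v0 : forall i, 0 <= mass_nu s i;
  ri_vB : forall i, i \notin rem_nu s -> mass_nu s i = 0;
  ri_q0 : forall j i, 0 <= moved s j i;
  ri_row : forall j, \sum_i moved s j i + mass_mu s j = omega j;
  ri_col : forall i, \sum_j moved s j i + mass_nu s i = theta i;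
  ri_mart : forall j, \sum_i moved s j i * (y i - x j) = 0;
  ri_cx : cx_le (mass_mu s) (mass_nu s);
  ri_gap : forall j k i, 0 < moved s j k -> i \in rem_nu s ->
    ~ (y k < y i <= x j) /\ ~ (x j <= y i < y k);
  ri_future : forall j0 j i, j0 \in rem_mu s -> x j0 < x j -> moved s j i = 0;
  ri_mono : forall j j' k1 k2 i, x j < x j' ->
    0 < moved s j k1 -> 0 < moved s j k2 -> 0 < moved s j' i ->
    ~ (y k1 < y i < y k2) }.

Lemma smallest_atom_left s s' j l r a b u : nearest_transfer s s' j l r a b ->
  u <= x j ->
  \sum_k mass_mu s' k * `|u - x k| = \sum_k mass_mu s' k * (x k - u).
Proof.
move=> T ux; apply: eq_bigr => k _.
have [kA|] := boolP (k \in rem_mu s').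
  have [_ /(_ _ (tr_A T kA)) xjk] := tr_min T.
  by rewrite distrC ger0_norm // subr_ge0 (le_trans ux).
rewrite (tr_wA T) lt_neqAle (tr_w0 T) andbT negbK => /eqP <-.
by rewrite !mul0r.
Qed.

(** A transfer to the nearest targets keeps the remainders in convex order.
    Left of [x j] the point at which the potentials are evaluated precedes all
    remaining mass of mu, so the potential of mu is there the affine function
    with the common mean, which bounds the potential of nu from below.  Right of [y r] the transfer changes both
    potentials by the same amount, because [x j] is the barycentre.  In
    between, the difference of potentials is concave, since the remainder of
    nu does not charge the open interval from [x j] to [y r], and a concave
    function that is nonnegative at the endpoints is nonnegative. *)
Lemma cx_le_transfer s s' j l r a b :
  cx_le (mass_mu s) (mass_nu s) -> nearest_transfer s s' j l r a b ->
  cx_le (mass_mu s') (mass_nu s').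
Proof.
move=> I T.
have mass : \sum_k mass_mu s' k = \sum_i mass_nu s' i.
  have := sum_decr_at2 (fun=> 1) (tr_v T).
  have := sum_decr_at (fun=> 1) (tr_w T).
  rewrite -!mulr_suml !mulr1 => -> ->; rewrite (cx_mass I); ring.
have mean : \sum_k mass_mu s' k * x k = \sum_i mass_nu s' i * y i.
  rewrite (sum_decr_at _ (tr_w T)) (sum_decr_at2 _ (tr_v T)).
  by rewrite (cx_mean I) -(tr_bary T); ring.
split=> // t.
pose W u := \sum_k mass_mu s' k * `|u - x k|.
pose V u := \sum_i mass_nu s' i * `|u - y i|.
have affine u := affine_eq u mass mean.
rewrite -/(W t) -/(V t).
have left_of u : u <= x j -> W u <= V u.
  move=> ux; rewrite /W (smallest_atom_left T ux) affine.
  apply: ler_sum => i _; rewrite ler_wpM2l ?(tr_v0 T) //.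
  by rewrite distrC ler_norm.
have right_of u : y r <= u -> W u <= V u.
  move=> ru; rewrite /W /V (sum_decr_at _ (tr_w T)) (sum_decr_at2 _ (tr_v T)).
  have := cx_potential I u; have := tr_bary T.
  have xr := tr_xr T; have lx := tr_lx T.
  rewrite !(@ger0_norm _ (u - x j), @ger0_norm _ (u - y l),
    @ger0_norm _ (u - y r)); [|lra..].
  by nra.
have [/left_of //|xt] := leP t (x j).
have [/right_of //|tr] := leP (y r) t.
have xtr : x j <= t <= y r by rewrite !ltW.
have r_x : 0 < y r - x j by rewrite subr_gt0 (lt_trans xt).
rewrite -(ler_pM2l r_x).
have Wle : (y r - x j) * W t <= (y r - t) * W (x j) + (t - x j) * W (y r).
  rewrite /W !mulr_sumr -big_split /=; apply: ler_sum => k _.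
  rewrite !(mulrCA _ (mass_mu s' k)) -mulrDr ler_wpM2l ?(tr_w0 T) //.
  exact: abs_chord.
have Vge : (y r - x j) * V t = (y r - t) * V (x j) + (t - x j) * V (y r).
  rewrite /V !mulr_sumr -big_split /=; apply: eq_bigr => i _.
  have [iB|/(tr_vB T) ->] := boolP (i \in rem_nu s');
    last by rewrite !mul0r !mulr0 addr0.
  rewrite !(mulrCA _ (mass_nu s' i)) -mulrDr; congr (_ * _).
  apply: abs_chord_eq => //.
  have [/ltW|/(tr_right T (tr_B T iB))] := ltP (y i) (x j); by [left|right].
rewrite Vge (le_trans Wle) //; apply: lerD; apply: ler_wpM2l.
- by rewrite subr_ge0 ltW.
- exact: left_of.
- by rewrite subr_ge0 ltW.
- exact: right_of.
Qed.

(** For [ri_mono], the only new used pairs are [(j, l)] and [(j, r)].  Rows to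
    the right of [x j] are still zero, so such a pair can only play the part
    of the later point; its target was still remaining, so by [ri_gap] it is
    not strictly between two targets of an earlier row. *)
Lemma run_invariant_transfer s s' j l r a b :
  injective x -> run_invariant s -> nearest_transfer s s' j l r a b ->
  run_invariant s'.
Proof.
move=> xI I T.
have [jA jmin] := tr_min T.
have qE k i := tr_q T k i.
have qother k i : k != j -> moved s' k i = moved s k i.
  by rewrite qE => /negbTE ->; rewrite mul0r addr0.
have qpos k i : 0 < moved s' k i ->
    0 < moved s k i \/ k = j /\ (i = l \/ i = r).
  rewrite qE; case: (eqVneq k j) => [->|_]; last by rewrite mul0r addr0; left.
  case: (eqVneq i l) => [->|_]; first by right; auto.
  case: (eqVneq i r) => [->|_]; first by right; auto.
  by rewrite !mul0r addr0 mulr0 addr0; left.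
split.
- exact: tr_w0 T.
- exact: tr_wA T.
- exact: tr_v0 T.
- exact: tr_vB T.
- move=> k i; rewrite qE addr_ge0 ?(ri_q0 I) // mulr_ge0 ?ler0n //.
  by rewrite addr_ge0 // mulr_ge0 ?ler0n ?(tr_a T, tr_b T).
- move=> k; rewrite -(ri_row I k) (tr_w T).
  under eq_bigr do rewrite qE.
  rewrite big_split /= -mulr_sumr big_split /=.
  by rewrite (sum_delta _ (fun=> a)) (sum_delta _ (fun=> b)); ring.
- move=> i; rewrite -(ri_col I i) (tr_v T).
  under eq_bigr do rewrite qE.
  by rewrite big_split /= (sum_delta _ (fun=> _)); ring.
- move=> k; under eq_bigr do rewrite qE mulrDl.
  rewrite big_split /= (ri_mart I) add0r.
  under eq_bigr do rewrite -mulrA mulrDl -!mulrA.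
  rewrite -mulr_sumr big_split /=.
  rewrite (sum_delta _ (fun i => a * (y i - x k))).
  rewrite (sum_delta _ (fun i => b * (y i - x k))).
  case: (eqVneq k j) => [->|_]; rewrite ?mul0r ?mul1r //.
  by have := tr_bary T; nra.
- exact: cx_le_transfer (ri_cx I) T.
- move=> k m i /qpos[qkm|[-> mlr]] iB.
    exact: ri_gap I _ _ _ qkm (tr_B T iB).
  have := tr_left T (tr_B T iB); have := tr_right T (tr_B T iB).
  have := tr_lx T; have := tr_xr T.
  move=> xr lx hr hl; split=> /andP[].
    by case: mlr => -> lt /[dup] /hl il ix; lra.
  by case: mlr => -> /[dup] /hr ir ix lt; lra.
- move=> j0 k i /(tr_A T) j0A lt; rewrite qother ?(ri_future I _ j0A) //.
  by apply: contraTneq lt => ->; rewrite -leNgt jmin.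
- move=> k k' m1 m2 i lt /qpos q1 /qpos q2 /qpos q3.
  have kA : k = j -> ~ 0 < moved s k' i.
    by move=> kj; rewrite (ri_future I _ jA) ?ltxx // -kj.
  have {}kA : k <> j.
    move=> kj; case: q3 => [/(kA kj)//|[k'j _]].
    by move: lt; rewrite kj k'j ltxx.
  case: q1 => [q1|[/kA//]]; case: q2 => [q2|[/kA//]].
  case: q3 => [q3|[_ ilr]]; first exact: ri_mono I _ _ _ _ _ lt q1 q2 q3.
  have iB : i \in rem_nu s by case: ilr => ->; [exact: tr_l T|exact: tr_r T].
  have [n1 _] := ri_gap I q1 iB; have [_ n2] := ri_gap I q2 iB.
  move=> /andP[i1 i2]; have [ix|xi] := leP (y i) (x k).
    by apply: n1; rewrite i1.
  by apply: n2; rewrite i2 ltW.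
Qed.


(** * Each step of the algorithm is such a transfer *)

Lemma split_mass_gt0 m a (l r : 'I_M) tl tr : 0 < m -> y l < a < y r ->
  split_mass y m a l r tl tr -> 0 < tl /\ 0 < tr.
Proof.
move=> m_gt0 /andP[la ar] [tl0 tr0 sum bary].
by split; rewrite lt_neqAle ?tl0 ?tr0 andbT; apply/eqP => t0; nra.
Qed.

Lemma split_mass_exists m a (l r : 'I_M) : 0 <= m -> y l < a < y r ->
  exists tl tr, split_mass y m a l r tl tr.
Proof.
move=> m_ge0 /andP[la ar].
have d0 : 0 < y r - y l by lra.
exists (m * (y r - a) / (y r - y l)), (m * (a - y l) / (y r - y l)).
split.
- by rewrite divr_ge0 ?(ltW d0) // mulr_ge0 // ltW // subr_gt0.
- by rewrite divr_ge0 ?(ltW d0) // mulr_ge0 // ltW // subr_gt0.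
- by field; rewrite gt_eqF.
- by field; rewrite gt_eqF.
Qed.

Lemma in_cross_if_empty (v : 'I_M -> R) l B i :
  i \notin cross_if_empty v l B -> i \notin B \/ v i = 0.
Proof.
rewrite /cross_if_empty; case: eqP => [vl0|_]; last by left.
by rewrite finset.in_setD1 negb_and negbK => /orP[/eqP ->|]; [right|left].
Qed.

Lemma cross_if_empty_sub (v : 'I_M -> R) l B :
  {subset cross_if_empty v l B <= B}.
Proof.
move=> i; rewrite /cross_if_empty; case: eqP => // _.
by rewrite finset.in_setD1 => /andP[].
Qed.

Lemma consecutive_nearest (B : {set 'I_M}) l r a :
  consecutive_atoms y B l r -> y l < a < y r ->
  [/\ l != r, forall i, i \in B -> y i <= a -> y i <= y l &
      forall i, i \in B -> a <= y i -> y r <= y i].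
Proof.
move=> [_ _ lr none] /andP[la ar]; split=> [|i iB ia|i iB ai].
- by apply: contraTneq lr => ->; rewrite ltxx.
- rewrite leNgt; apply/negP => li;
  by apply: (none i iB); rewrite li (le_lt_trans ia).
- rewrite leNgt; apply/negP => ir;
  by apply: (none i iB); rewrite ir (lt_le_trans la).
Qed.

(** The bound on [mass_nu s r] is weak on purpose: in a tie of the two quotients
    it is an equality, and [y r] stays in the list with no mass left. *)
Lemma exhaust_left_transfer s j l r tl tr :
  run_invariant s -> smallest_atom x (rem_mu s) j ->
  consecutive_atoms y (rem_nu s) l r -> y l < x j < y r ->
  split_mass y (mass_mu s j) (x j) l r tl tr ->
  mass_nu s l < tl -> mass_nu s l / tl * tr <= mass_nu s r ->
  nearest_transfer s (exhaust_left s j l r tl tr) j l r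
    (mass_nu s l) (mass_nu s l / tl * tr).
Proof.
case: s => A B w v q /= I jm lr lxr sp vl vr.
have wj : 0 < w j by rewrite -(ri_wA I); case: jm.
have [tl0 tr0] := split_mass_gt0 wj lxr sp.
have [lnr nl nr] := consecutive_nearest lr lxr.
have [lB rB _ _] := lr; have [_ _ sum bary] := sp.
have [lx xr] := andP lxr.
set k := v l / tl in vr *.
have k0 : 0 <= k by rewrite divr_ge0 ?(ri_v0 I) // ltW.
have k1 : k < 1 by rewrite ltr_pdivrMr // mul1r.
have ktl : v l = k * tl by rewrite /k divfK // gt_eqF.
have wE : w j * (1 - k) = w j - (v l + k * tr) by rewrite ktl -sum; ring.
have w'0 : 0 < w j * (1 - k) by rewrite mulr_gt0 // subr_gt0.
split=> //=; rewrite ?(ltW lx) ?(ltW xr) ?(ri_v0 I) //.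
- by rewrite mulr_ge0 // ltW.
- by rewrite ktl -mulrDr sum -[RHS]mulrA -bary; ring.
- by move=> m; case: eqVneq => [->|_]; rewrite ?mul1r ?mul0r ?wE; ring.
- move=> i; case: eqVneq => [->|il].
    by rewrite (negbTE lnr) ?mul1r ?mul0r; ring.
  by case: eqVneq => [->|ir]; rewrite ?mul1r ?mul0r; ring.
- move=> m i; rewrite /add_moved.
  case: (eqVneq m j) => [->|_] /=; last by rewrite mul0r; ring.
  case: (eqVneq i r) => [->|_];
    last by case: eqVneq => _ /=; rewrite ?mul1r ?mul0r; ring.
  by rewrite eq_sym (negbTE lnr) ?mul1r ?mul0r; ring.
- by move=> i; rewrite finset.in_setD1 => /andP[].
- by move=> m; case: eqVneq => [_|_]; rewrite ?(ltW w'0) ?(ri_w0 I).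
- move=> m; rewrite (ri_wA I) /=; case: eqVneq => [->|_] //.
  by rewrite wj w'0.
- move=> i; case: eqVneq => // _; case: eqVneq => _; last exact: (ri_v0 I).
  by rewrite subr_ge0.
- move=> i; rewrite finset.in_setD1 negb_and negbK; case: eqVneq => //= _ iB.
  case: eqVneq => [ir|_]; last exact: ri_vB I _ iB.
  by rewrite ir rB in iB.
Qed.

Lemma exhaust_right_transfer s j l r tl tr :
  run_invariant s -> smallest_atom x (rem_mu s) j ->
  consecutive_atoms y (rem_nu s) l r -> y l < x j < y r ->
  split_mass y (mass_mu s j) (x j) l r tl tr ->
  mass_nu s r < tr -> mass_nu s r / tr * tl <= mass_nu s l ->
  nearest_transfer s (exhaust_right s j l r tl tr) j l r
    (mass_nu s r / tr * tl) (mass_nu s r).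
Proof.
case: s => A B w v q /= I jm lr lxr sp vr vl.
have wj : 0 < w j by rewrite -(ri_wA I); case: jm.
have [tl0 tr0] := split_mass_gt0 wj lxr sp.
have [lnr nl nr] := consecutive_nearest lr lxr.
have [lB rB _ _] := lr; have [_ _ sum bary] := sp.
have [lx xr] := andP lxr.
set k := v r / tr in vl *.
have k0 : 0 <= k by rewrite divr_ge0 ?(ri_v0 I) // ltW.
have k1 : k < 1 by rewrite ltr_pdivrMr // mul1r.
have ktr : v r = k * tr by rewrite /k divfK // gt_eqF.
have wE : w j * (1 - k) = w j - (k * tl + v r) by rewrite ktr -sum; ring.
have w'0 : 0 < w j * (1 - k) by rewrite mulr_gt0 // subr_gt0.
split=> //=; rewrite ?(ltW lx) ?(ltW xr) ?(ri_v0 I) //.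
- by rewrite mulr_ge0 // ltW.
- by rewrite ktr -mulrDr sum -[RHS]mulrA -bary; ring.
- by move=> m; case: eqVneq => [->|_]; rewrite ?mul1r ?mul0r ?wE; ring.
- move=> i; case: eqVneq => [->|il].
    by rewrite (negbTE lnr) ?mul1r ?mul0r; ring.
  by case: eqVneq => [->|ir]; rewrite ?mul1r ?mul0r; ring.
- move=> m i; rewrite /add_moved.
  case: (eqVneq m j) => [->|_] /=; last by rewrite mul0r; ring.
  case: (eqVneq i r) => [->|_];
    last by case: eqVneq => _ /=; rewrite ?mul1r ?mul0r; ring.
  by rewrite eq_sym (negbTE lnr) ?mul1r ?mul0r; ring.
- by move=> i; rewrite finset.in_setD1 => /andP[].
- by move=> m; case: eqVneq => [_|_]; rewrite ?(ltW w'0) ?(ri_w0 I).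
- move=> m; rewrite (ri_wA I) /=; case: eqVneq => [->|_] //.
  by rewrite wj w'0.
- move=> i; case: eqVneq => [_|_]; first by rewrite subr_ge0.
  by case: eqVneq => // _; exact: (ri_v0 I).
- move=> i; rewrite finset.in_setD1 negb_and negbK; case: (eqVneq i r) => [->|_] /= iB.
    by rewrite eq_sym (negbTE lnr).
  case: eqVneq => [il|_]; last exact: ri_vB I _ iB.
  by rewrite il lB in iB.
Qed.

Lemma step_transfer s s' : run_invariant s -> step x y s s' ->
  exists j l r a b, nearest_transfer s s' j l r a b.
Proof.
move=> + st; case: st.
- move=> A B w v q j l jm lB xy wv v' I.
  have wj : 0 < w j by rewrite -(ri_wA I); case: jm.
  exists j, l, l, (w j), 0.
  split=> //=; rewrite ?xy ?(ltW wj) ?mul0r ?addr0 //.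
  + by move=> m; case: eqVneq => [->|_]; rewrite ?mul1r ?mul0r; ring.
  + by move=> i; rewrite /v' /=; case: eqVneq => [->|_]; rewrite ?mul1r ?mul0r; ring.
  + move=> m i; rewrite /add_moved.
    by case: eqVneq => _; case: eqVneq => _ /=; rewrite ?mul1r ?mul0r; ring.
  + by move=> m; rewrite finset.in_setD1 => /andP[].
  + exact: cross_if_empty_sub.
  + by move=> m; case: eqVneq => // _; exact: ri_w0 I m.
  + move=> m; rewrite finset.in_setD1 (ri_wA I) /=.
    by case: eqVneq => [_|]; rewrite ?ltxx.
  + move=> i; rewrite /v' /=; case: eqVneq => _; first by rewrite subr_ge0.
    exact: ri_v0 I i.
  + move=> i /in_cross_if_empty[iB|//]; rewrite /v' /=.
    by case: eqVneq => [il|_]; [rewrite il lB in iB|exact: ri_vB I i iB].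
- move=> A B w v q j l jm lB xy wv I.
  have wj : 0 < w j by rewrite -(ri_wA I); case: jm.
  have vl : 0 <= v l by exact: ri_v0 I l.
  exists j, l, l, (v l), 0.
  split=> //=; rewrite ?xy ?mul0r ?addr0 //.
  + by move=> m; case: eqVneq => [->|_]; rewrite ?mul1r ?mul0r; ring.
  + by move=> i; case: eqVneq => [->|_]; rewrite ?mul1r ?mul0r; ring.
  + move=> m i; rewrite /add_moved.
    by case: eqVneq => _; case: eqVneq => _ /=; rewrite ?mul1r ?mul0r; ring.
  + by move=> m; rewrite finset.in_setD1 => /andP[].
  + move=> m; case: eqVneq => _; first by rewrite subr_ge0 ltW.
    exact: ri_w0 I m.
  + move=> m; rewrite (ri_wA I) /=; case: eqVneq => // ->.
    by rewrite wj subr_gt0 wv.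
  + by move=> i; case: eqVneq => // _; exact: ri_v0 I i.
  + move=> i; rewrite finset.in_setD1 negb_and negbK; case: eqVneq => //= _ iB.
    exact: ri_vB I i iB.
- move=> A B w v q j l r tl tr jm lr lxr sp vl vr v' I.
  have wj : 0 < w j by rewrite -(ri_wA I); case: jm.
  have [lnr nl nr] := consecutive_nearest lr lxr.
  have [lB rB _ _] := lr; have [tl0 tr0 sum bary] := sp.
  have [lx xr] := andP lxr.
  exists j, l, r, tl, tr.
  split=> //=; rewrite ?(ltW lx) ?(ltW xr) ?sum //.
  + by move=> m; case: eqVneq => [->|_]; rewrite ?mul1r ?mul0r; ring.
  + move=> i; rewrite /v' /=; case: eqVneq => [->|il].
      by rewrite (negbTE lnr) ?mul1r ?mul0r; ring.
    by case: eqVneq => [->|ir]; rewrite ?mul1r ?mul0r; ring.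
  + move=> m i; rewrite /add_moved.
    case: (eqVneq m j) => [->|_] /=; last by rewrite mul0r; ring.
    case: (eqVneq i r) => [->|_];
    last by case: eqVneq => _ /=; rewrite ?mul1r ?mul0r; ring.
    by rewrite eq_sym (negbTE lnr) ?mul1r ?mul0r; ring.
  + by move=> m; rewrite finset.in_setD1 => /andP[].
  + by move=> i /cross_if_empty_sub/cross_if_empty_sub.
  + by move=> m; case: eqVneq => // _; exact: ri_w0 I m.
  + move=> m; rewrite finset.in_setD1 (ri_wA I) /=.
    by case: eqVneq => [_|]; rewrite ?ltxx.
  + move=> i; rewrite /v' /=; case: eqVneq => _; first by rewrite subr_ge0.
    case: eqVneq => _; first by rewrite subr_ge0.
    exact: ri_v0 I i.
  + move=> i /in_cross_if_empty[/in_cross_if_empty[iB|//]|//]; rewrite /v' /=.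
    case: eqVneq => [il|_]; first by rewrite il lB in iB.
    by case: eqVneq => [ir|_]; [rewrite ir rB in iB|exact: ri_vB I i iB].
- move=> {}s j l r tl tr jm lr lxr sp vl vr I.
  exists j, l, r, (mass_nu s l), (mass_nu s l / tl * tr).
  apply: exhaust_left_transfer => //; apply: le_trans vr.
  have wj : 0 < mass_mu s j by rewrite -(ri_wA I); case: jm.
  have [tl0 tr0] := split_mass_gt0 wj lxr sp.
  by rewrite ler_piMl ?ltW // ltr_pdivrMr // mul1r.
- move=> {}s j l r tl tr jm lr lxr sp vl vr I.
  exists j, l, r, (mass_nu s r / tr * tl), (mass_nu s r).
  apply: exhaust_right_transfer => //; apply: le_trans vl.
  have wj : 0 < mass_mu s j by rewrite -(ri_wA I); case: jm.
  have [tl0 tr0] := split_mass_gt0 wj lxr sp.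
  by rewrite ler_piMl ?ltW // ltr_pdivrMr // mul1r.
- move=> {}s j l r tl tr jm lr lxr sp vl vr mn I.
  exists j, l, r, (mass_nu s l), (mass_nu s l / tl * tr).
  apply: exhaust_left_transfer => //.
  have wj : 0 < mass_mu s j by rewrite -(ri_wA I); case: jm.
  have [tl0 tr0] := split_mass_gt0 wj lxr sp.
  by rewrite -ler_pdivlMr // -mn ge_min lexx orbT.
- move=> {}s j l r tl tr jm lr lxr sp vl vr mn I.
  exists j, l, r, (mass_nu s r / tr * tl), (mass_nu s r).
  apply: exhaust_right_transfer => //.
  have wj : 0 < mass_mu s j by rewrite -(ri_wA I); case: jm.
  have [tl0 tr0] := split_mass_gt0 wj lxr sp.
  by rewrite -ler_pdivlMr // -mn ge_min lexx.
Qed.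

(** * Termination and progress *)

(** Every step crosses out at least one atom. *)
Lemma step_decreases s s' : step x y s s' ->
  (#|rem_mu s'| + #|rem_nu s'| < #|rem_mu s| + #|rem_nu s|)%N.
Proof.
have D1 n (A : {set 'I_n}) i : i \in A -> (#|A :\ i|%SET < #|A|)%N.
  by move=> iA; rewrite [in ltnRHS](cardsD1 i A) iA.
have cr (v : 'I_M -> R) i B : (#|cross_if_empty v i B| <= #|B|)%N.
  by apply/subset_leq_card/fintype.subsetP; exact: cross_if_empty_sub.
case=> [A B w v q j l [jA _] *|A B w v q j l _ lB *
  |A B w v q j l r tl tr [jA _] *|[A B w v q] j l r tl tr _ [lB rB _ _] *
  |[A B w v q] j l r tl tr _ [lB rB _ _] *
  |[A B w v q] j l r tl tr _ [lB rB _ _] *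
  |[A B w v q] j l r tl tr _ [lB rB _ _] *] /=;
  rewrite ?ltn_add2l; try exact: D1.
- by rewrite -addSn leq_add ?D1.
- by rewrite -addSn leq_add ?D1 // (leq_trans (cr _ _ _)).
Qed.

Lemma step_Acc s : Acc (fun s2 s1 => step x y s1 s2) s.
Proof.
have [n] := ubnP (#|rem_mu s| + #|rem_nu s|).
elim: n s => [s|n IHn s]; first by rewrite ltn0.
rewrite ltnS => sn; constructor => s' /step_decreases s's.
by apply: IHn; exact: leq_trans s's sn.
Qed.

(** Convex order prevents the algorithm from getting stuck.  If all remaining
    targets were left of [x j], the mean of nu would be too small.  If all were
    right of it, take [t] to be the leftmost target: the potential of nu at [t]
    is then the affine function with the common mean, whereas the potential of
    mu at [t] is strictly above it, because [x j] lies left of [t]. *)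
Lemma targets_surround s j : run_invariant s -> smallest_atom x (rem_mu s) j ->
  (exists2 l, l \in rem_nu s & y l <= x j) /\
  (exists2 r, r \in rem_nu s & x j <= y r).
Proof.
move=> I [jA jmin].
have wj : 0 < mass_mu s j by rewrite -(ri_wA I).
have off k : k \notin rem_mu s -> mass_mu s k = 0.
  rewrite (ri_wA I) lt_neqAle (ri_w0 I) andbT negbK eq_sym; exact: eqP.
have affine t := affine_eq t (cx_mass (ri_cx I)) (cx_mean (ri_cx I)).
have [r rB xr] : exists2 r, r \in rem_nu s & x j <= y r.
  apply: contrapT => none.
  have lt i : i \in rem_nu s -> y i < x j.
    by move=> iB; rewrite ltNge; apply/negP => xi; apply: none; exists i.
  have term_ge0 i : true -> 0 <= mass_nu s i * (x j - y i).
    move=> _; have [iB|iB] := boolP (i \in rem_nu s).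
      by rewrite mulr_ge0 ?(ri_v0 I) // subr_ge0 ltW ?lt.
    by rewrite (ri_vB I) // mul0r.
  have le0 : \sum_i mass_nu s i * (x j - y i) <= 0.
    rewrite -[leRHS]oppr0 -[leLHS]opprK lerN2 -sumrN.
    under eq_bigr do rewrite -mulrN opprB.
    rewrite -affine sumr_ge0 // => k _.
    have [kA|/off ->] := boolP (k \in rem_mu s); last by rewrite mul0r.
    by rewrite mulr_ge0 ?(ri_w0 I) // subr_ge0 jmin.
  have eq0 : \sum_i mass_nu s i * (x j - y i) = 0.
    by apply/eqP; rewrite eq_le le0 sumr_ge0.
  have v0 i : mass_nu s i = 0.
    have [iB|/(ri_vB I) //] := boolP (i \in rem_nu s).
    have /eqP := psumr_eq0P term_ge0 eq0 (erefl (true)) (i:=i).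
    by rewrite mulf_eq0 subr_eq0 [x j == _]gt_eqF ?lt // orbF => /eqP.
  have : 0 < \sum_k mass_mu s k.
    rewrite (bigD1 j) //= ltr_pwDl // sumr_ge0 // => k _; exact: ri_w0 I k.
  by rewrite (cx_mass (ri_cx I)) big1 ?ltxx.
split; last by exists r.
apply: contrapT => none.
have lt i : i \in rem_nu s -> x j < y i.
  by move=> iB; rewrite ltNge; apply/negP => xi; apply: none; exists i.
case: (arg_minP y rB) => m mB mmin.
have := cx_potential (ri_cx I) (y m).
have -> : \sum_i mass_nu s i * `|y m - y i| =
    \sum_i mass_nu s i * (y i - y m).
  apply: eq_bigr => i _; have [iB|/(ri_vB I) ->] := boolP (i \in rem_nu s).
    by rewrite distrC ger0_norm // subr_ge0 mmin.
  by rewrite !mul0r.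
rewrite -affine; apply/negP; rewrite -ltNge.
rewrite (bigD1 j) //= [ltRHS](bigD1 j) //=; apply: ltr_leD.
  rewrite ltr_pM2l //; apply: (@lt_trans _ _ 0); first by rewrite subr_lt0 lt.
  by rewrite normr_gt0 subr_eq0 gt_eqF ?lt.
apply: ler_sum => k _; rewrite ler_wpM2l ?(ri_w0 I) //.
by rewrite distrC ler_norm.
Qed.

Lemma step_exists s : run_invariant s -> rem_mu s <> finset.set0 ->
  exists s', step x y s s'.
Proof.
move=> I /eqP/finset.set0Pn[j0 j0A].
have sE : s = State (rem_mu s) (rem_nu s) (mass_mu s) (mass_nu s) (moved s).
  by case: (s).
case: (arg_minP x j0A) => j jA jmin.
have jm : smallest_atom x (rem_mu s) j by split.
have [[l0 l0B l0x] [r0 r0B xr0]] := targets_surround I jm.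
pose leftward i := (i \in rem_nu s) && (y i <= x j).
pose rightward i := (i \in rem_nu s) && (x j <= y i).
have l0P : leftward l0 by rewrite /leftward l0B.
have r0P : rightward r0 by rewrite /rightward r0B.
case: (@arg_maxP _ _ _ l0 leftward y l0P) => l /andP[lB lx] lmax.
case: (@arg_minP _ _ _ r0 rightward y r0P) => r /andP[rB xr] rmin.
have wj : 0 < mass_mu s j by rewrite -(ri_wA I).
have [xl|xl] := eqVneq (x j) (y l).
  rewrite sE; have [wv|vw] := leP (mass_mu s j) (mass_nu s l).
    by eexists; exact: step_I1 jm lB xl wv.
  by eexists; exact: step_I2 jm lB xl vw.
have xl' : y l < x j by rewrite lt_neqAle eq_sym xl.
have xr' : x j < y r.
  rewrite lt_neqAle xr andbT; apply/eqP => xyr.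
  have := lmax r; rewrite /leftward rB xyr lexx => /(_ isT) /=.
  by rewrite leNgt; rewrite xyr in xl'; rewrite xl'.
have cons : consecutive_atoms y (rem_nu s) l r.
  split=> // [|i iB /andP[li ir]]; first exact: lt_trans xr'.
  have [ix|xi] := leP (y i) (x j).
    by have := lmax i; rewrite /leftward iB ix => /(_ isT) /=;
      rewrite leNgt li.
  by have := rmin i; rewrite /rightward iB ltW // => /(_ isT) /=;
    rewrite leNgt ir.
have lxr : y l < x j < y r by rewrite xl' xr'.
have [tl [tr sp]] := split_mass_exists (ltW wj) lxr.
have [vl|vl] := leP tl (mass_nu s l); have [vr|vr] := leP tr (mass_nu s r).
- by rewrite sE; eexists; exact: step_II1 jm cons lxr sp vl vr.
- by eexists; exact: step_II3 jm cons lxr sp vl vr.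
- by eexists; exact: step_II2 jm cons lxr sp vl vr.
- have [mn|mn] :
      Num.min (mass_nu s l / tl) (mass_nu s r / tr) = mass_nu s l / tl \/
      Num.min (mass_nu s l / tl) (mass_nu s r / tr) = mass_nu s r / tr.
    by rewrite minElt; case: ifP; [left|right].
  + by eexists; exact: step_II4_left jm cons lxr sp vl vr mn.
  + by eexists; exact: step_II4_right jm cons lxr sp vl vr mn.
Qed.

Lemma run_invariant_init : (forall j, 0 < omega j) -> (forall i, 0 < theta i) ->
  cx_le omega theta -> run_invariant (init_state omega theta).
Proof.
move=> w0 v0 cx; split=> //=.
- by move=> j; rewrite ltW.
- by move=> j; rewrite inE w0.
- by move=> i; rewrite ltW.
- by move=> i; rewrite inE.
- by move=> j; rewrite big1 // add0r.
- by move=> i; rewrite big1 // add0r.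
- by move=> j; rewrite big1 // => i _; rewrite mul0r.
- by move=> j k i; rewrite ltxx.
- by move=> j j' k1 k2 i _; rewrite ltxx.
Qed.

Lemma run_invariant_reachable s s' : injective x -> run_invariant s ->
  reachable x y s s' -> run_invariant s'.
Proof.
move=> xI + run; elim: run => [s1 s2 st I|//|s1 s2 s3 _ IH1 _ IH2 I].
  have [j [l [r [a [b T]]]]] := step_transfer I st.
  exact: run_invariant_transfer T.
by apply: IH2; exact: IH1.
Qed.

(** The remainders always have equal mass, so when mu is used up, so is nu. *)
Lemma marginals_final s : run_invariant s -> rem_mu s = finset.set0 ->
  (forall j, \sum_i moved s j i = omega j) /\
  (forall i, \sum_j moved s j i = theta i).
Proof.
move=> I A0.
have w0 j : mass_mu s j = 0.
  have := ri_wA I j; rewrite A0 inE lt_neqAle (ri_w0 I) andbT.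
  by move=> /esym/negbFE/eqP.
have v0 i : mass_nu s i = 0.
  have v_sum : \sum_i mass_nu s i = 0 by rewrite -(cx_mass (ri_cx I)) big1.
  by apply: (psumr_eq0P _ v_sum) => // k _; exact: ri_v0 I k.
split=> [j|i]; first by rewrite -(ri_row I j) w0 addr0.
by rewrite -(ri_col I i) v0 addr0.
Qed.

End Runs.

(** * Finitely supported measures *)

Section DiscreteMeasure.
Context d (T : measurableType d) (R : realType) (I : finType).
Variables (a : I -> T) (w : I -> R).

(** A sequence indexed by [nat] rather than [I], the format of [msum]; the
    absolute value makes each coefficient nonnegative by its type, as [mscale]
    demands. *)
Definition weighted_dirac (n : nat) : {measure set T -> \bar R} :=
  if insub n is Some k then
    mscale (`|w (enum_val (k : 'I_#|I|))|%:nng) \d_(a (enum_val k))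
  else mzero.

Definition discrete_measure : {measure set T -> \bar R} :=
  msum weighted_dirac #|I|.

Hypothesis w_ge0 : forall i, 0 <= w i.

Lemma discrete_measureE : atomic_measure a w discrete_measure.
Proof.
move=> A mA; rewrite /discrete_measure /= /msum [RHS]big_enum_val.
apply: eq_bigr => k _; rewrite /weighted_dirac valK /= /mscale /=.
by rewrite ger0_norm.
Qed.

Lemma ge0_integral_atomic (m : {measure set T -> \bar R}) (f : T -> R) :
  atomic_measure a w m -> measurable_fun setT f -> (forall t, 0 <= f t) ->
  (\int[m]_t (f t)%:E = (\sum_i w i * f (a i))%:E)%E.
Proof.
move=> mE mf f0.
rewrite (@eq_measure_integral _ _ _ setT discrete_measure); last first.
  by move=> A mA _; rewrite mE // discrete_measureE.
have mf' : measurable_fun setT (EFin \o f) by exact/measurable_EFinP.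
rewrite ge0_integral_measure_sum //; last by move=> t _; rewrite lee_fin.
rewrite -sumEFin [RHS]big_enum_val; apply: eq_bigr => k _.
rewrite /weighted_dirac valK.
rewrite ge0_integral_mscale //; last by move=> t _; rewrite lee_fin.
by rewrite integral_dirac // diracE in_setT mul1e /= ger0_norm.
Qed.

Lemma ge0_integrable_atomic (m : {measure set T -> \bar R}) (f : T -> R) :
  atomic_measure a w m -> measurable_fun setT f -> (forall t, 0 <= f t) ->
  m.-integrable setT (EFin \o f).
Proof.
move=> mE mf f0; apply/integrableP; split; first exact/measurable_EFinP.
under eq_integral do rewrite /= ger0_norm //.
by rewrite ge0_integral_atomic // ltry.
Qed.

Lemma atomic_point_gt0 (m : {measure set T -> \bar R}) (A : set T) i :
  atomic_measure a w m -> measurable A -> A (a i) -> 0 < w i -> (0 < m A)%E.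
Proof.
move=> mE mA Aai wi; rewrite mE // (bigD1 i) //= diracE mem_set // mule1.
apply: (@lt_le_trans _ _ (w i)%:E); first by rewrite lte_fin.
by rewrite leeDl // sume_ge0 // => k _; rewrite mule_ge0 // lee_fin.
Qed.

Lemma atomic_full (m : {measure set T -> \bar R}) (A : set T) :
  atomic_measure a w m -> measurable A -> (forall i, 0 < w i -> A (a i)) ->
  m A = (\sum_i w i)%:E.
Proof.
move=> mE mA full; rewrite mE // -sumEFin; apply: eq_bigr => i _.
have [wi|] := ltP 0 (w i).
  by rewrite diracE mem_set ?mule1 //; exact: full.
move=> wi0; have /eqP <- : 0 == w i by rewrite eq_le w_ge0 wi0.
by rewrite mul0e.
Qed.

End DiscreteMeasure.

Lemma discrete_probability d (T : measurableType d) (R : realType) (I : finType)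
    (a : I -> T) (w : I -> R) : (forall i, 0 <= w i) -> \sum_i w i = 1 ->
  exists Q : probability T R, atomic_measure a w Q.
Proof.
move=> w0 w1; pose m := discrete_measure a w.
have m1 : m setT = 1%E by rewrite (atomic_full w0 (discrete_measureE a w0)) ?w1.
pose Q : probability T R := HB.pack (m : set T -> \bar R) (Measure.on m)
  (Measure_isProbability.Build _ _ _ m m1).
by exists Q; exact: discrete_measureE.
Qed.

Lemma convex_function_dist (R : realType) (t : R) :
  @convex_function R R^o [set: R] (fun c : R => `|t - c|).
Proof.
move=> k p q _ _.
have [k0 k1] : 0 <= k%:num /\ 0 <= 1 - k%:num by rewrite subr_ge0; split.
have -> : conv k p q = k%:num * p + (1 - k%:num) * q by [].
have -> : conv k (`|t - p| : R^o) `|t - q| =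
    k%:num * `|t - p| + (1 - k%:num) * `|t - q| by [].
have -> : t - (k%:num * p + (1 - k%:num) * q) =
    k%:num * (t - p) + (1 - k%:num) * (t - q) by ring.
by apply: le_trans (ler_normD _ _) _; rewrite !normrM (ger0_norm k0) (ger0_norm k1).
Qed.

(** Only the convex functions [c |-> |t - c|] are tested.  For [t] to the right
    of all atoms the inequality compares the means in one direction, and for
    [t] to the left of all atoms in the other, so the means agree. *)
Lemma cx_le_of_convex_order (R : realType) (N M : nat)
    (x omega : 'I_N -> R) (y theta : 'I_M -> R)
    (mu nu : probability (measurableTypeR R) R) :
  (forall j, 0 <= omega j) -> (forall i, 0 <= theta i) ->
  \sum_(j < N) omega j = 1 -> \sum_(i < M) theta i = 1 ->
  @atomic_measure _ (measurableTypeR R) R 'I_N x omega mu ->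
  @atomic_measure _ (measurableTypeR R) R 'I_M y theta nu ->
  convex_order mu nu -> cx_le x y omega theta.
Proof.
move=> w0 v0 w1 v1 muE nuE cx.
have pot t : \sum_j omega j * `|t - x j| <= \sum_i theta i * `|t - y i|.
  have mf : measurable_fun [set: measurableTypeR R] (fun c : R => `|t - c|).
    apply: measurableT_comp; first exact: normr_measurable.
    exact: measurable_funB.
  have := cx _ (convex_function_dist t)
    (ge0_integrable_atomic w0 muE mf (fun=> normr_ge0 _))
    (ge0_integrable_atomic v0 nuE mf (fun=> normr_ge0 _)).
  rewrite (ge0_integral_atomic w0 muE mf) // (ge0_integral_atomic v0 nuE mf) //.
split=> //; first by rewrite w1.
have lin (I : finType) (w c : I -> R) t : \sum_i w i = 1 ->
    \sum_i w i * (t - c i) = t - \sum_i w i * c i.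
  move=> sum1; under eq_bigr do rewrite mulrBr.
  by rewrite sumrB -mulr_suml sum1 mul1r.
have right (I : finType) (w c : I -> R) t : (forall i, `|c i| <= t) ->
    \sum_i w i = 1 -> \sum_i w i * `|t - c i| = t - \sum_i w i * c i.
  move=> ct /(lin _ w c) <-; apply: eq_bigr => i _.
  by rewrite ger0_norm // subr_ge0 (le_trans (ler_norm _)).
have left (I : finType) (w c : I -> R) t : (forall i, `|c i| <= t) ->
    \sum_i w i = 1 -> \sum_i w i * `|- t - c i| = t + \sum_i w i * c i.
  move=> ct sum1; have := lin _ w (fun i => - c i) t sum1.
  under [in RHS]eq_bigr do rewrite mulrN.
  rewrite sumrN opprK => <-; apply: eq_bigr => i _.
  have := ler_norm (- c i); have := ct i; rewrite normrN => ci cN.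
  by rewrite ler0_norm; [congr (_ * _); ring|lra].
pose C := \sum_j `|x j| + \sum_i `|y i|.
have xC j : `|x j| <= C.
  rewrite /C (bigD1 j) //= -addrA lerDl addr_ge0 // sumr_ge0 //.
have yC i : `|y i| <= C.
  rewrite /C (bigD1 i) //= addrCA lerDl addr_ge0 // sumr_ge0 //.
have := pot (- C); rewrite (left _ _ _ _ xC w1) (left _ _ _ _ yC v1).
have := pot C; rewrite (right _ _ _ _ xC w1) (right _ _ _ _ yC v1).
by lra.
Qed.

(** * The main theorem *)

Theorem theorem5p5 (R : realType) (N M : nat)
    (x omega : 'I_N -> R) (y theta : 'I_M -> R)
    (mu nu : probability (measurableTypeR R) R)
    (N_ge2 : (2 <= N)%N)
    (x_incr : forall j1 j2 : 'I_N, (j1 < j2)%N -> x j1 < x j2)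
    (y_incr : forall i1 i2 : 'I_M, (i1 < i2)%N -> y i1 < y i2)
    (omega_gt0 : forall j, 0 < omega j)
    (theta_gt0 : forall i, 0 < theta i)
    (omega_sum : \sum_(j < N) omega j = 1)
    (theta_sum : \sum_(i < M) theta i = 1)
    (mu_def : @atomic_measure _ (measurableTypeR R) R 'I_N x omega mu)
    (nu_def : @atomic_measure _ (measurableTypeR R) R 'I_M y theta nu)
    (mu_le_nu : convex_order mu nu)
    (mu_neq_nu : ~ (forall A, measurable A -> mu A = nu A)) :
  terminates x y (init_state omega theta) /\
  forall q : 'I_N -> 'I_M -> R, output x y (init_state omega theta) q ->
    exists Q : probability (measurableTypeR R * measurableTypeR R)%type R,
      [/\ plan_of x y q Q,
          Q \in martingale_plans x omega y theta &
          left_monotone mu nu Q].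
Proof.
have xI : injective x.
  move=> j1 j2 xj; case: (ltngtP j1 j2) => [/x_incr|/x_incr|/val_inj //];
    by rewrite xj ltxx.
have omega_ge0 j : 0 <= omega j by exact: ltW.
have theta_ge0 i : 0 <= theta i by exact: ltW.
have I0 : run_invariant x omega y theta (init_state omega theta).
  apply: run_invariant_init => //.
  exact: cx_le_of_convex_order mu_le_nu.
split.
  split; first exact: step_Acc.
  by move=> s /(run_invariant_reachable xI I0); exact: step_exists.
move=> q [s [/(run_invariant_reachable xI I0) I A0 <-]].
have [row col] := marginals_final I A0.
have q_ge0 ji : 0 <= moved s ji.1 ji.2 by exact: ri_q0 I _ _.
have q_sum : \sum_ji moved s ji.1 ji.2 = 1.
  by rewrite -(pair_bigA _ (moved s)) -omega_sum;
    apply: eq_bigr => j _; exact: row.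
have [Q QE] := discrete_probability (atom_pair x y) q_ge0 q_sum.
exists Q; split=> //.
  by apply: mem_set; exists (moved s); split=> // *;
    [exact: ri_q0 I _ _|exact: ri_mart I _].
pose Gamma : set (measurableTypeR R * measurableTypeR R) :=
  \bigcup_(ji in [set ji | 0 < moved s ji.1 ji.2]) [set atom_pair x y ji].
have GammaP a b : Gamma (a, b) ->
    exists j i, [/\ a = x j, b = y i & 0 < moved s j i].
  by move=> [[j i] /= qji [-> ->]]; exists j, i.
have mGamma : measurable Gamma.
  apply: fin_bigcup_measurable => // -[j i] _.
  rewrite -[X in measurable X](_ : [set x j] `*` [set y i] = _); last first.
    by apply/seteqP; split=> -[a b] /= [-> ->].
  by apply: measurableX; exact: measurable_set1.
exists Gamma; split=> //.
- move=> -[a b] /GammaP[j [i [-> -> _]]]; split=> U /= oU Ux.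
    exact: atomic_point_gt0 mu_def (open_measurable oU) Ux (omega_gt0 j).
  exact: atomic_point_gt0 nu_def (open_measurable oU) Ux (theta_gt0 i).
- by rewrite (atomic_full q_ge0 QE) ?q_sum // => ji qji; exists ji.
- move=> a b1 b2 a' b' /GammaP[j [k1 [-> -> q1]]] /GammaP[j' [k2 [/xI <- -> q2]]].
  move=> /GammaP[m [i [-> -> q3]]] lt.
  exact: ri_mono I _ _ _ _ _ lt q1 q2 q3.
Qed.
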